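(* Let $r\ge 2$, $s\ge 1$ and $n\ge s$ be integers. Every $n\times\cdots\times n$ $r$-partite graph with minimum degree at least $\left(r-1-\frac{1}{2s^2}\right)n$ contains $K_r(s)$ as a subgraph.
   Context: All graphs are finite and simple. An $n\times\cdots\times n$ $r$-partite graph is a graph whose vertex set is partitioned into $r$ independent sets (parts), each of size exactly $n$. $K_r(s)$ denotes the complete $r$-partite graph with exactly $s$ vertices in each part. *)

(* Defs.v *)
From mathcomp Require Import all_boot all_order all_algebra.

Set Implicit Arguments.
Unset Strict Implicit.
Unset Printing Implicit Defensive.

(* A finite simple graph is a finType with a symmetric irreflexive relation. *)
Definition simple_graph (T : finType) (e : rel T) : Prop :=
  symmetric e /\ irreflexive e.

Definition independent (T : finType) (e : rel T) (A : {set T}) : Prop :=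
  {in A &, forall x y, ~~ e x y}.

(* The partition into r parts is given by the map sending a vertex to the
   index of its part. *)
Definition balanced_multipartite (r n : nat) (T : finType) (e : rel T) : Prop :=
  exists part : T -> 'I_r,
    forall i : 'I_r,
      independent e [set x | part x == i] /\ #|[set x | part x == i]| = n.

Definition degree (T : finType) (e : rel T) (x : T) : nat := #|[set y | e x y]|.

(* Degrees never exceed #|T|, so this default value affects the minimum only
   when T is empty. *)
Definition min_degree (T : finType) (e : rel T) : nat :=
  \big[minn/#|T|]_(x : T) degree e x.

Definition complete_multipartite (r s : nat) : rel ('I_r * 'I_s) :=
  fun u v => u.1 != v.1.

(* Not necessarily induced. *)
Definition contains_subgraph (S T : finType) (eH : rel S) (eG : rel T) : Prop :=
  exists f : S -> T, injective f /\ (forall u v, eH u v -> eG (f u) (f v)).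

(* Main.v *)
Require Import Defs.
From mathcomp Require Import all_boot all_order all_algebra.
From mathcomp Require Import zify ring.
Import Order.TTheory GRing.Theory Num.Theory.

(** Pass to the graph [m] of missing edges between distinct parts: by the degree
condition its maximum degree [D] satisfies [2 s^2 D <= n].  Cut every part into
[s] classes of size at least [n %/ s], hence at least [2 D].  By Haxell's
theorem the [r s] classes have a transversal which is independent in [m]; since
[m] has no edges inside a part, its vertices span K_r(s).

Haxell's theorem follows from a domination statement: if a partial independent
transversal missing only the class [i0] cannot be replaced by a full one, then
some set [S] of classes containing [i0] is dominated by at most [2 (#|S| - 1)]
vertices, which is too few to dominate [2 D #|S|] vertices.  To see this, take [w]
in class [i0] and an edge from [w] to a vertex [t] of the transversal.  If
deleting [wt] still leaves no independent transversal, induct on the number of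
edges.  Otherwise a transversal of the graph without [wt] uses both [w] and [t];
delete the neighbours of [w] and [t], merge their two classes, and induct on
the number of classes. *)

(** * Independent transversals and Haxell's theorem *)

Section Haxell.

Variables T I : finType.
Implicit Types (e : rel T) (p : T -> I) (A : {set T}) (J S : {set I}).

Definition ind_transversal e p A J (f : I -> T) : Prop :=
  {in J, forall i, f i \in A /\ p (f i) = i} /\
  {in J &, forall i j, ~~ e (f i) (f j)}.

(** Total domination: for irreflexive [e], a vertex of [Z] does not dominate itself, so [Z] has to
    be covered by its own neighbourhoods too. *)
Definition dominates e p A S (Z : {set T}) : Prop :=
  forall x, x \in A -> p x \in S -> exists2 z, z \in Z & e z x.

Definition edge_count e := #|[set u : T * T | e u.1 u.2]|.

Definition del_edge e (w t : T) : rel T :=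
  fun x y => e x y && ~~ ((x == w) && (y == t) || (x == t) && (y == w)).

Definition merge p (i j : I) : T -> I := fun x => if p x == j then i else p x.

Definition del_nbrs e A (w t : T) := [set x in A | ~~ e w x & ~~ e t x].

Lemma del_edge_sym e w t : symmetric e -> symmetric (del_edge e w t).
Proof.
move=> se x y; rewrite /del_edge se; congr (_ && ~~ _).
by rewrite orbC; congr (_ || _); rewrite andbC.
Qed.

Lemma del_edge_irr e w t : irreflexive e -> irreflexive (del_edge e w t).
Proof. by move=> ie x; rewrite /del_edge ie. Qed.

Lemma edge_count_del e w t :
  e w t -> (edge_count (del_edge e w t) < edge_count e)%N.
Proof.
move=> ewt; apply: proper_card; apply/properP; split.
  by apply/subsetP=> u; rewrite !inE => /andP[].
by exists (w, t); rewrite !inE //= /del_edge !eqxx andbF.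
Qed.

(** The vertex [h i] of the merged class lies in class [i] or [j] of [p]. The other class receives
    [w] or [t], which creates no conflict because the neighbours of both were deleted. *)
Lemma ind_transversal_merge e p A J (i j : I) (w t : T) h :
    symmetric e -> irreflexive e -> i \in J -> i != j ->
    w \in A -> p w = i -> t \in A -> p t = j ->
    ind_transversal e (merge p i j) (del_nbrs e A w t) (J :\ j) h ->
  exists f, ind_transversal e p A J f.
Proof.
move=> se ie iJ nij wA pw tA pt [hA he].
have iJ' : i \in J :\ j by rewrite !inE nij.
have hJ k : k \in J :\ j ->
  [/\ h k \in A, ~~ e w (h k), ~~ e t (h k) & merge p i j (h k) = k].
  by move=> /hA[]; rewrite !inE => /and3P[].
have hp k : k \in J -> k != j -> k != i -> p (h k) = k.
  move=> kJ kj ki; have /hJ[_ _ _] : k \in J :\ j by rewrite !inE kj.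
  by rewrite /merge; case: ifP => // _ ik; rewrite ik eqxx in ki.
have [_ _ _] := hJ _ iJ'; rewrite {1}/merge; case: ifP => [/eqP phj _|_ phi].
- exists (fun k => if k == i then w else if k == j then h i else h k); split.
    move=> k kJ; case: eqP => [->//|/eqP ki]; case: eqP => [->|/eqP kj].
      by split=> //; case: (hJ _ iJ').
    have kJ' : k \in J :\ j by rewrite !inE kj.
    by split; [case: (hJ _ kJ') | apply: hp].
  have H k : k \in J -> k != i -> ~~ e w (if k == j then h i else h k).
    move=> kJ ki; case: eqP => [_|/eqP kj]; first by case: (hJ _ iJ').
    by have /hJ[] : k \in J :\ j by rewrite !inE kj.
  move=> k l kJ lJ.
  have [_|/eqP ki] := k =P i; have [_|/eqP li] := l =P i.
  + by rewrite ie.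
  + exact: H.
  + by rewrite se; apply: H.
  + case: eqP => [_|/eqP kj]; case: eqP => [_|/eqP lj]; apply: he => //;
      by rewrite !inE ?kj ?lj.
- exists (fun k => if k == j then t else h k); split.
    move=> k kJ; case: eqP => [->//|/eqP kj].
    have kJ' : k \in J :\ j by rewrite !inE kj.
    split; first by case: (hJ _ kJ').
    by have [->//|/eqP ki] := k =P i; apply: hp.
  move=> k l kJ lJ; case: eqP => [_|/eqP kj]; case: eqP => [_|/eqP lj].
  + by rewrite ie.
  + by have /hJ[] : l \in J :\ j by rewrite !inE lj.
  + by rewrite se; have /hJ[] : k \in J :\ j by rewrite !inE kj.
  + by apply: he; rewrite !inE ?kj ?lj.
Qed.

(** The only possible edge of [e] among the values of [g] joins [g i] to [g j], so all other values
    survive the deletion. *)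
Lemma ind_transversal_unmerge e p A J (i j : I) g :
    ind_transversal (del_edge e (g i) (g j)) p A J g ->
    i \in J -> j \in J -> i != j ->
  ind_transversal e (merge p i j) (del_nbrs e A (g i) (g j)) (J :\ j :\ i) g.
Proof.
move=> [gA ge] iJ jJ nij.
have g_inj : {in J &, injective g}.
  by move=> k l /gA[_ pk] /gA[_ pl] gkl; rewrite -pk gkl pl.
have gne k l : k \in J -> l \in J -> k != l -> g k != g l.
  by move=> kJ lJ; apply: contraNneq => /g_inj ->.
have H k l : k \in J -> l \in J -> k != i -> k != j -> ~~ e (g l) (g k).
  move=> kJ lJ ki kj; apply: contra (ge _ _ lJ kJ) => elk.
  rewrite /del_edge elk (negPf (gne _ _ kJ iJ ki)) (negPf (gne _ _ kJ jJ kj)).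
  by rewrite !andbF.
split=> [k|k l]; rewrite !inE => /and3P[ki kj kJ].
  have [gkA pk] := gA _ kJ.
  by rewrite gkA !H //= /merge pk (negPf kj).
by case/and3P=> li lj lJ; apply: H.
Qed.

Lemma transversal_or_dominated e p A J i0 f :
    symmetric e -> irreflexive e -> i0 \in J ->
    ind_transversal e p A (J :\ i0) f ->
  (exists g, ind_transversal e p A J g) \/
  exists S (Z : {set T}), [/\ S \subset J, i0 \in S, (#|Z| + 2 <= 2 * #|S|)%N &
                  dominates e p A S Z].
Proof.
(* Deleting an edge lowers the second summand; merging lowers the first and keeps [e]. *)
have [m] := ubnP (#|J| + edge_count e).
elim: m => // m IH in e p A J f * => lem se ie i0J [fA fe].
have [w /andP[wA /eqP pw]|noA] := pickP [pred x in A | p x == i0]; last first.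
  right; exists [set i0], set0; split; rewrite ?sub1set ?set11 ?cards0 ?cards1 //.
  by move=> x xA /set1P px; have := noA x; rewrite /= xA px eqxx.
have [j /andP[jJ ewt]|now] := pickP [pred j in J :\ i0 | e w (f j)]; last first.
  left; exists (fun i => if i == i0 then w else f i); split.
    by move=> i iJ; case: eqP => [->//|/eqP ni]; apply: fA; rewrite !inE ni.
  have H i : i \in J -> i != i0 -> ~~ e w (f i).
    by move=> iJ ni; have := now i; rewrite /= !inE ni iJ /= => ->.
  move=> i j iJ jJ; case: eqP => [_|/eqP ni]; case: eqP => [_|/eqP nj].
  - by rewrite ie.
  - exact: H.
  - by rewrite se; apply: H.
  - by apply: fe; rewrite !inE ?ni ?nj.
have [tA pt] := fA _ jJ; set t := f j in ewt tA pt.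
have [nji0 jJ1] : j != i0 /\ j \in J by move: jJ; rewrite !inE => /andP[].
set e' := del_edge e w t.
have pf' : ind_transversal e' p A (J :\ i0) f.
  by split=> // k l kJ lJ; rewrite /e' /del_edge negb_and fe.
have [||//|[g gIT]|[S [Z [SJ iS cZ dZ]]]] := IH e' p A J f _ _ _ i0J pf'.
- have lt := edge_count_del e w t ewt; rewrite -/e' in lt; lia.
- exact: del_edge_sym.
- exact: del_edge_irr.
(* Unless [g] uses both ends of the deleted edge, it is independent in [e] as well. *)
- have [/andP[/eqP gw /eqP gt]|ngwt] := boolP ((g i0 == w) && (g j == t)); last first.
    left; exists g; have [gA ge] := gIT; split=> // k l kJ lJ.
    have [_ pk] := gA _ kJ; have [_ pl] := gA _ lJ.
    apply: contra (ge _ _ kJ lJ) => ekl; rewrite /e' /del_edge ekl /=.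
    apply: contra ngwt => /orP[]/andP[/eqP gk /eqP gl];
      move: pk pl; rewrite gk gl pw pt => ki lj; rewrite ?ki ?lj.
      by rewrite gk gl !eqxx.
    by rewrite gk gl !eqxx.
  have nij : i0 != j by rewrite eq_sym.
  rewrite /e' -gw -gt in gIT.
  have := ind_transversal_unmerge e p A J i0 j g gIT i0J jJ1 nij.
  rewrite gw gt => uIT.
  have [|//|//||[h hIT]|[S [Z [SJ iS cZ dZ]]]] :=
    IH e (merge p i0 j) (del_nbrs e A w t) (J :\ j) g _ _ _ _ uIT.
  + by move: lem; rewrite (cardsD1 j J) jJ1; lia.
  + by rewrite !inE nij.
  + left; exact: (ind_transversal_merge _ _ _ _ _ _ _ _ _ se ie i0J nij wA pw tA pt hIT).
  + have jS : j \notin S by apply/negP=> /(subsetP SJ); rewrite !inE eqxx.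
    (* One more class pays for the two vertices [w] and [t], which dominate everything deleted.
       Class [j] is covered because it was merged into [i0], a member of [S]. *)
    right; exists (j |: S), (w |: (t |: Z)); split.
    * apply/subsetP=> k /setU1P[->//|/(subsetP SJ)]; by rewrite !inE => /andP[].
    * by rewrite !inE iS orbT.
    * by rewrite [#|j |: S|]cardsU1 jS !cardsU1; lia.
    move=> x xA pxS.
    have [ewx|nwx] := boolP (e w x); first by exists w; rewrite ?setU11.
    have [etx|ntx] := boolP (e t x).
      by exists t; rewrite // !inE eqxx orbT.
    have [||z zZ ezx] := dZ x; first by rewrite !inE xA nwx.
      by rewrite /merge; case: eqP pxS => [//|/eqP nj]; rewrite !inE (negPf nj).
    by exists z; rewrite // !inE zZ !orbT.
- right; exists S, Z; split=> // x xA /(dZ x xA)[z zZ /andP[ezx _]].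
  by exists z.
Qed.

Lemma card_dominated e p S (Z : {set T}) D :
    (forall x, degree e x <= D)%N -> dominates e p setT S Z ->
  (#|[set x | p x \in S]| <= #|Z| * D)%N.
Proof.
move=> dD dom.
have sub : [set x | p x \in S] \subset \bigcup_(z in Z) [set x | e z x].
  apply/subsetP=> x; rewrite inE => /(dom x (in_setT x))[z zZ ezx].
  by apply/bigcupP; exists z; rewrite ?inE.
apply: leq_trans (subset_leq_card sub) _.
rewrite -sum_nat_const; elim/big_rec2: _ => [|z B k _ le]; first by rewrite cards0.
apply: leq_trans (leq_card_setU _ _).1 _.
by rewrite leq_add // dD.
Qed.

Lemma card_fibers_ge p S k :
    (forall i, k <= #|[set x | p x == i]|)%N ->
  (#|S| * k <= #|[set x | p x \in S]|)%N.
Proof.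
move=> kle; rewrite -sum_nat_const -sum1_card.
rewrite (partition_big p (mem S)) /=; last by move=> x; rewrite inE.
apply: leq_sum => i iS; apply: leq_trans (kle i) _.
rewrite -sum1_card leq_eqVlt; apply/orP; left; apply/eqP.
by apply: eq_bigl => x; rewrite !inE; case: eqP => [->|]; rewrite ?iS ?andbF.
Qed.

Theorem haxell e p D k :
    symmetric e -> irreflexive e -> (0 < k)%N -> (2 * D <= k)%N ->
    (forall x, degree e x <= D)%N ->
    (forall i, k <= #|[set x | p x == i]|)%N ->
  exists f, ind_transversal e p setT setT f.
Proof.
move=> se ie k0 Dk dD kle.
have fib i : exists x, p x == i.
  have /card_gt0P[x] := leq_trans k0 (kle i); rewrite inE => px.
  by exists x.
suff H m J : #|J| = m -> exists f, ind_transversal e p setT J f by exact: (H _ setT erefl).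
elim: m J => [|m IH] J cJ.
  exists (fun i => xchoose (fib i)).
  by move/eqP: cJ; rewrite cards_eq0 => /eqP->; split=> i; rewrite inE.
have /card_gt0P[i0 i0J] : (0 < #|J|)%N by rewrite cJ.
have [|f fIT] := IH (J :\ i0); first by move: cJ; rewrite (cardsD1 i0) i0J => -[].
have [//|[S [Z [_ i0S cZ dZ]]]] :=
  transversal_or_dominated e p setT J i0 f se ie i0J fIT.
(* Contradiction: [#|S| * k <= #|Z| * D <= (#|S| - 1) * k] with [k] positive. *)
have := leq_trans (card_fibers_ge p S k kle) (card_dominated e p S Z D dD dZ).
have : (0 < #|S|)%N by apply/card_gt0P; exists i0.
nia.
Qed.

End Haxell.

(** * Splitting the parts and counting missing edges *)

Lemma equitable_split (T : finType) (A : {set T}) (s : nat) (a : 'I_s) :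
  (#|A| %/ s <= #|[set x in A | index x (enum A) %% s == a :> nat]|)%N.
Proof.
have s0 : (0 < s)%N by apply: leq_trans (ltn_ord a).
have [->|/set0Pn[x0 _]] := eqVneq A set0; first by rewrite cards0 div0n.
have bnd (b : 'I_(#|A| %/ s)) : (a + b * s < size (enum A))%N.
  rewrite -cardE; have := leq_trunc_div #|A| s; have := ltn_ord a; have := ltn_ord b.
  nia.
pose h (b : 'I_(#|A| %/ s)) := nth x0 (enum A) (a + b * s).
have hinj : injective h.
  move=> b c /eqP; rewrite /h nth_uniq ?enum_uniq ?bnd // eqn_add2l eqn_pmul2r //.
  by move/eqP/val_inj.
rewrite -[X in (X <= _)%N]card_ord -(card_imset _ hinj); apply: subset_leq_card.
apply/subsetP=> x /imsetP[b _ ->]; rewrite /h inE -mem_enum mem_nth ?bnd //.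
by rewrite index_uniq ?enum_uniq ?bnd //= addnC modnMDl modn_small ?ltn_ord /=.
Qed.

Lemma min_degree_le (T : finType) (e : rel T) x : (min_degree e <= degree e x)%N.
Proof.
rewrite /min_degree; have := mem_index_enum x.
elim: (index_enum T) => // y l IH; rewrite inE big_cons => /predU1P[<-|/IH].
  exact: geq_minl.
by apply: leq_trans; apply: geq_minr.
Qed.

Definition missing (T : finType) r (e : rel T) (part : T -> 'I_r) : rel T :=
  fun x y => (part x != part y) && ~~ e x y.

(** Parts are independent, so the vertices outside the part of [x] split into its neighbours and its
    missing neighbours. *)
Lemma degree_missing (T : finType) r n (e : rel T) (part : T -> 'I_r) x :
    (forall i, independent e [set y | part y == i] /\ #|[set y | part y == i]| = n) ->
  (degree (missing T r e part) x + degree e x + n = r * n)%N.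
Proof.
move=> hp.
have eT : #|T| = (r * n)%N.
  rewrite -sum1_card (partition_big part xpredT) //=.
  under eq_bigr => i _.
    under eq_bigl => y do rewrite -[part y == i](in_set (fun y => part y == i)).
    rewrite sum1_card (proj2 (hp i)); over.
  by rewrite sum_nat_const card_ord.
rewrite -eT -cardsT; have [indx <-] := hp (part x).
rewrite -(cardsID [set y | part y == part x] setT) setTI setTD addnC; congr (_ + _)%N.
rewrite -(cardsID [set y | e x y] (~: _)) addnC /degree; congr (_ + _)%N; apply: eq_card => y;
  rewrite !inE /missing ?[part x == _]eq_sym //.
  apply/idP/andP => [exy|[]//]; split=> //; apply/negP=> pxy.
  by have := indx x y; rewrite !inE eqxx pxy exy => /(_ isT isT).
by rewrite andbC.
Qed.

(** The degree hypothesis with denominators cleared, kept free of truncated subtraction. *)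
Lemma missing_bound (r s n d : nat) :
    (1 <= s)%N ->
    ((r%:R - 1 - 1 / (2 * s%:R ^+ 2)) * n%:R <= d%:R :> rat)%R ->
  (2 * s ^ 2 * (r * n) <= 2 * s ^ 2 * (d + n) + n)%N.
Proof.
move=> s1 H; pose q : rat := (2 * s%:R ^+ 2)%R.
have q0 : (0 < q)%R by rewrite mulr_gt0 // exprn_gt0 // ltr0n.
have : (q * ((r%:R - 1 - 1 / q) * n%:R) <= q * d%:R)%R by rewrite ler_wpM2l // ltW.
have -> : (q * ((r%:R - 1 - 1 / q) * n%:R) = q * (r%:R * n%:R) - q * n%:R - n%:R)%R.
  by field; rewrite gt_eqF.
by rewrite !lerBlDr addrAC -mulrDr /q -natrX -!(natrM, natrD) ler_nat.
Qed.

Local Open Scope ring_scope.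

Theorem mainTheorem5 (r s n : nat) (hr : (2 <= r)%N) (hs : (1 <= s)%N)
    (hn : (s <= n)%N) (T : finType) (e : rel T)
    (hG : simple_graph e) (hpart : balanced_multipartite r n e)
    (hdeg : (r%:R - 1 - 1 / (2 * s%:R ^+ 2)) * n%:R <= (min_degree e)%:R :> rat) :
  contains_subgraph (@complete_multipartite r s) e.
Proof.
have [part hp] := hpart; have [se ie] := hG.
pose m := missing T r e part.
pose fib i := [set x | part x == i].
(* The class labels are exactly the vertices of K_r(s), so a transversal is itself the embedding. *)
pose p x := (part x, Ordinal (ltn_pmod (index x (enum (fib (part x)))) hs)).
have sm : symmetric m by move=> x y; rewrite /m /missing eq_sym se.
have im : irreflexive m by move=> x; rewrite /m /missing eqxx.
have dm x : (degree m x <= r * n - n - min_degree e)%N.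
  by have := degree_missing T r n e part x hp; have := min_degree_le T e x;
     rewrite -/m; lia.
have k0 : (0 < n %/ s)%N by rewrite divn_gt0.
have kD : (2 * (r * n - n - min_degree e) <= n %/ s)%N.
  (* With [D] the bound on missing degrees, the goal is now [2 * D * s <= n], and [missing_bound]
     gives [2 * s ^ 2 * D <= n]. *)
  rewrite leq_divRL //; have := missing_bound r s n _ hs hdeg; nia.
have kle (i : 'I_r * 'I_s) : (n %/ s <= #|[set x | p x == i]|)%N.
  case: i => i a; have := equitable_split T (fib i) s a.
  rewrite (proj2 (hp i)) => /leq_trans; apply; apply: subset_leq_card.
  apply/subsetP=> x; rewrite !inE => /andP[/eqP px /eqP ix].
  by apply/eqP; congr (_, _) => //; apply: val_inj; rewrite /= px.
have [f [fp fm]] := haxell T _ m p _ _ sm im k0 kD dm kle.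
have pf u : p (f u) = u by case: (fp u (in_setT u)).
exists f; split=> [u v fuv|u v uv]; first by rewrite -(pf u) fuv pf.
have := fm u v (in_setT _) (in_setT _).
rewrite /m /missing -[part (f u)]/(p (f u)).1 -[part (f v)]/(p (f v)).1 !pf.
by rewrite negb_and negbK (negPf uv) negbK.
Qed.
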